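(* Let $(P,\preceq,\vee)$ be a locally finite join semilattice, $S=\{x_1,x_2,\ldots,x_n\}$ a finite subset of $P$ ordered such that $x_i\preceq x_j$ only if $i\leq j$, let $f$ be any real-valued function on $P$, and let $d\geq 2$ be an integer. Then every eigenvalue of the $n$-dimensional order $d$ join tensor $[S_d]_f$ lies in the region \[ \bigcup_{i=1}^n\{z\in\mathbb{C}: |z-f(x_i)|\leq (n^{d-1}-1)c_i\}, \] where \[ c_i=\max_{\substack{i_2,\ldots,i_d\in\{1,2,\ldots,n\}\\ \delta(i,i_2,\ldots,i_d)=0}}|f(x_i\vee x_{i_2}\vee\cdots\vee x_{i_d})|\quad\text{for }i\in\{1,2,\ldots,n\} \] (for $n=1$ the maximum is over the empty set and $c_1$ is taken to be $0$).
   Context: A poset $(P,\preceq)$ is locally finite if $\{z\in P\mid x\preceq z\preceq y\}$ is finite for all $x,y\in P$. A join semilattice is a nonempty poset in which any two elements $x,y$ have a least upper bound $x\vee y$. The order $d$ join tensor on $S$ with respect to $f$ is the $n$-dimensional order $d$ tensor with $([S_d]_f)_{i_1,\ldots,i_d}=f(x_{i_1}\vee\cdots\vee x_{i_d})$, $i_1,\ldots,i_d\in\{1,\ldots,n\}$. $\delta(i_1,i_2,\ldots,i_d)=1$ if $i_1=i_2=\cdots=i_d$, and $0$ otherwise. For an $n$-dimensional order $d$ tensor $A$ and a vector $v=(v_1,\ldots,v_n)^{\mathrm T}\in\mathbb{C}^n$, $Av^{d-1}\in\mathbb{C}^n$ is the vector with entries $(Av^{d-1})_i=\sum_{i_2,\ldots,i_d=1}^n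 A_{i,i_2,\ldots,i_d}v_{i_2}\cdots v_{i_d}$, and $v^{[d-1]}=(v_1^{d-1},\ldots,v_n^{d-1})^{\mathrm T}$. A number $\lambda\in\mathbb{C}$ is an eigenvalue of $A$ if $Av^{d-1}=\lambda v^{[d-1]}$ for some nonzero $v\in\mathbb{C}^n$. *)

(* Defs.v *)
From mathcomp Require Import all_boot all_order all_algebra.
From mathcomp Require Import classical_sets cardinality reals.
From mathcomp Require Import complex.

Set Implicit Arguments.
Unset Strict Implicit.
Unset Printing Implicit Defensive.

Import Order.TTheory GRing.Theory Num.Theory.
Local Open Scope ring_scope.
Local Open Scope complex_scope.
Local Open Scope classical_set_scope.

Definition locally_finite (disp : Order.disp_t) (P : porderType disp) : Prop :=
  forall x y : P, finite_set [set z : P | (x <= z <= y)%O].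

(* An n-dimensional tensor of order d >= 1.  The first index is kept apart from
   the tuple (i_2, ..., i_d) of the d - 1 others, as in A v^(d-1). *)
Definition tensor (T : Type) (n d : nat) : Type :=
  'I_n -> d.-1.-tuple 'I_n -> T.

Definition map_tensor (T U : Type) (g : T -> U) (n d : nat)
    (A : tensor T n d) : tensor U n d :=
  fun i t => g (A i t).

(* foldl computes (((x_i \/ x_i2) \/ x_i3) \/ ...) \/ x_id. *)
Definition join_tensor (disp : Order.disp_t) (P : joinSemilatticeType disp)
    (T : Type) (n d : nat) (x : 'I_n -> P) (f : P -> T) : tensor T n d :=
  fun i t => f (foldl Order.join (x i) [seq x j | j <- t]).

Definition delta (n d : nat) (i : 'I_n) (t : d.-1.-tuple 'I_n) : nat :=
  if [forall k, tnth t k == i] then 1%N else 0%N.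

(* A v^(d-1) *)
Definition tensor_apply (C : comNzRingType) (n d : nat) (A : tensor C n d)
    (v : 'cV[C]_n) : 'cV[C]_n :=
  \col_i \sum_(t : d.-1.-tuple 'I_n) A i t * \prod_(k < d.-1) v (tnth t k) 0.

(* v^[d-1] *)
Definition entrywise_pow (C : comNzRingType) (n d : nat) (v : 'cV[C]_n) :
    'cV[C]_n :=
  \col_i v i 0 ^+ d.-1.

Definition tensor_eigenvalue (C : comNzRingType) (n d : nat)
    (A : tensor C n d) (lambda : C) : Prop :=
  exists2 v : 'cV[C]_n,
    v != 0 & tensor_apply A v = lambda *: entrywise_pow d v.

(* The maximum is that of a family of nonnegative reals, so starting it at 0
   only matters for the empty family (n = 1), where it yields 0. *)
Definition offdiag_max (R : realType) (n d : nat) (A : tensor R n d)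
    (i : 'I_n) : R :=
  \big[Num.max/0]_(t : d.-1.-tuple 'I_n | delta i t == 0%N) `|A i t|.

(* Main.v *)
(* Compare the eigenvalue equation at an index where |v_i| is maximal, as for
   Gershgorin's disks: the n^(d-1) - 1 off-diagonal terms are each bounded by
   c_i |v_i|^(d-1).  On the diagonal, idempotence of the join gives f(x_i). *)
Require Import Defs.
From mathcomp Require Import all_boot all_order all_algebra.
From mathcomp Require Import classical_sets cardinality reals.
From mathcomp Require Import complex.

Set Implicit Arguments.
Unset Strict Implicit.
Unset Printing Implicit Defensive.

Import Order.TTheory GRing.Theory Num.Theory.
Local Open Scope ring_scope.
Local Open Scope complex_scope.
Local Open Scope classical_set_scope.

(** The order on [C] may be partial, as it is on complex numbers, but norms are real and hence
    pairwise comparable, so a largest one exists. *)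
Lemma max_norm_entry (C : numDomainType) (n : nat) (v : 'cV[C]_n) :
  v != 0 ->
  exists2 i, v i 0 != 0 & forall j, `|v j 0| <= `|v i 0|.
Proof.
move=> v_neq0; have [i0 vi0] : exists i, v i 0 != 0.
  apply/existsP; rewrite -negb_forall; apply: contraNN v_neq0.
  move=> /forallP v0; apply/eqP/matrixP => i j.
  by rewrite ord1 mxE; apply/eqP; have:= v0 i.
have [i _ max_i] : extremum_spec >=%O predT (fun i => `|v i 0|)
    [arg max_(i > i0) `|v i 0|]%O.
  apply: comparable_arg_maxP => // i j _ _.
  by apply: real_comparable; rewrite normr_real.
exists i => [|j]; last exact: max_i.
by rewrite -normr_gt0 (lt_le_trans _ (max_i i0 isT)) ?normr_gt0.
Qed.

Lemma delta_eq0 (n d : nat) (i : 'I_n) (t : d.-1.-tuple 'I_n) :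
  (delta i t == 0%N) = (t != [tuple of nseq d.-1 i]).
Proof.
rewrite /delta; case: forallP => [ti | nti]; symmetry.
  apply/negbTE; rewrite negbK; apply/eqP/eq_from_tnth => k.
  by rewrite (eqP (ti k)) tnth_nseq.
by apply/eqP => ti; apply: nti => k; rewrite ti tnth_nseq.
Qed.

(** The row bounds [b] are arbitrary, so no maximum has to be formed in the partially ordered
    [C]. *)
Lemma tensor_gershgorin (C : numDomainType) (n d : nat) (A : tensor C n d)
    (b : 'I_n -> C) (lambda : C) :
  (forall i t, delta i t == 0%N -> `|A i t| <= b i) ->
  tensor_eigenvalue A lambda ->
  exists i, `|lambda - A i [tuple of nseq d.-1 i]| <=
    (n%:R ^+ d.-1 - 1) * b i.
Proof.
move=> Ab [v /max_norm_entry[i vi_neq0 vi_max] /matrixP/(_ i 0)].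
rewrite !mxE (bigD1 [tuple of nseq d.-1 i]) //=.
under eq_bigr do rewrite tnth_nseq.
rewrite prodr_const card_ord => Av; exists i.
have vi_gt0 : 0 < `|v i 0| ^+ d.-1 by rewrite exprn_gt0 ?normr_gt0.
(* After scaling by the positive [|v_i|^(d-1)], the eigenvalue equation replaces
   [lambda * v_i^(d-1)]; the diagonal term cancels and only the off-diagonal sum is left. *)
rewrite -(ler_pM2r vi_gt0) -normrX -normrM mulrBl -Av [X in X - _]addrC addrK.
(* The factor counts the off-diagonal tuples. The index [i] forces [n > 0], so the truncated
   subtraction agrees with the one in [C]. *)
have -> : n%:R ^+ d.-1 - 1 =
    #|[pred t : d.-1.-tuple 'I_n | t != [tuple of nseq d.-1 i]]|%:R :> C.
  by rewrite cardC1 -[#|_|.-1]subn1 card_tuple card_ord natrB ?natrX // expn_gt0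
    (leq_ltn_trans _ (ltn_ord i)).
rewrite -mulrA mulr_natl -sumr_const.
apply: (le_trans (ler_norm_sum _ _ _)); apply: ler_sum => t t_offdiag.
rewrite normrM ler_pM ?Ab ?delta_eq0 // normr_prod normrX.
(* Writing the power of [|v_i|] as a product over the [d - 1] positions allows a factorwise
   comparison. *)
rewrite -[d.-1 in leRHS]card_ord -prodr_const.
by apply: ler_prod => k _; rewrite normr_ge0 vi_max.
Qed.

Lemma join_tensor_diag (disp : Order.disp_t) (P : joinSemilatticeType disp)
    (T : Type) (n d : nat) (x : 'I_n -> P) (f : P -> T) (i : 'I_n) :
  (join_tensor x f : tensor T n d) i [tuple of nseq d.-1 i] = f (x i).
Proof.
by rewrite /join_tensor /=; elim: d.-1 => //= m IHm; rewrite joinxx.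
Qed.

Theorem proposition5p1 (R : realType) (disp : Order.disp_t)
    (P : joinSemilatticeType disp) (P_nonempty : inhabited P)
    (P_locally_finite : locally_finite P)
    (n : nat) (x : 'I_n -> P) (x_inj : injective x)
    (x_ordered : forall i j : 'I_n, (x i <= x j)%O -> (i <= j)%N)
    (f : P -> R) (d : nat) (d_ge2 : (2 <= d)%N) :
  let A := join_tensor x f : tensor R n d in
  let c := offdiag_max A in
  [set lambda : R[i] | tensor_eigenvalue (map_tensor (real_complex R) A) lambda]
  `<=` \bigcup_(i : 'I_n)
    [set z : R[i] | `|z - (f (x i))%:C| <= ((n%:R ^+ d.-1 - 1) * c i)%:C].
Proof.
move=> A c lambda /=.
have Ac i t : delta i t == 0%N ->
    `|map_tensor (real_complex R) A i t| <= (c i)%:C.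
  move=> t_offdiag.
  (* The modulus of an embedded real [r] is [sqrt(r^2 + 0^2) = |r|], which reduces the bound to one
     between reals. *)
  by rewrite normc_def /= expr0n addr0 sqrtr_sqr lecR le_bigmax_cond.
case/(tensor_gershgorin Ac) => i.
rewrite /map_tensor /A join_tensor_diag => le_i.
(* The real radius is pushed through the ring embedding into [R[i]], to match the radius computed
   there. *)
exists i => //=; rewrite rmorphM rmorphB rmorphXn rmorph1 rmorph_nat.
exact: le_i.
Qed.
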